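(* Let $p\in[1,\infty]$, $\alpha_p>0$, $\epsilon\ge0$ and $\beta\in[1,\infty]$. Let $\mathrm m:\mathcal X\to\mathcal P(\mathcal Y)$ be a randomized classifier that is $(\alpha_p,\epsilon)$-robust with respect to the Renyi divergence $D_\beta$. Then $$\mathcal R^{adv}(\mathrm m;\alpha_p)-\mathcal R(\mathrm m)\le 1-e^{-\epsilon}\,\mathbb E_{x\sim\mathcal D_{\mid\mathcal X}}\left[e^{-H(\mathrm m(x))}\right],$$ where $H(\rho)=-\sum_{k\in\mathcal Y}\rho_k\log\rho_k$ is the Shannon entropy of $\rho\in\mathcal P(\mathcal Y)$ and $\mathcal D_{\mid\mathcal X}$ is the marginal distribution of $\mathcal D$ on $\mathcal X$.
   Context: $\mathcal X\subset[-1,1]^d$ is the input space, $\mathcal Y=\{1,\dots,K\}$ the label set, $\mathcal D$ a probability distribution on $\mathcal X\times\mathcal Y$. $\mathcal P(\mathcal Y)$ is the set of probability measures on $\mathcal Y$; $\rho_k=\rho(\{k\})$; $\log$ is the natural logarithm and $0\log 0=0$. A randomized classifier is a map $\mathrm m:\mathcal X\to\mathcal P(\mathcal Y)$. All functions are assumed measurable so that the expectations below make sense. Renyi divergence of order $\beta$: if $\rho,\rho'$ have densities $g,g'$ w.r.t. a common measure $\nu$, then for $\beta\in(1,\infty)$, $D_\beta(\rho,\rho')=\frac1{\beta-1}\log\int g'\,(g/g')^\beta\,d\nu$ (equal to $+\infty$ if $\rho$ is not absolutely continuous w.r.t. $\rho'$); for $\beta=1$ it is the Kullback–Leibler divergence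 $\int g\log(g/g')\,d\nu$; for $\beta=\infty$ it is the limit as $\beta\to\infty$ (the maximum divergence, $\log\operatorname{ess\,sup} g/g'$). For a metric/divergence $D$ on $\mathcal P(\mathcal Y)$, $\mathrm m$ is $(\alpha_p,\epsilon)$-robust w.r.t. $D$ if for all $x,x'\in\mathcal X$ with $\|x-x'\|_p\le\alpha_p$ one has $D(\mathrm m(x),\mathrm m(x'))\le\epsilon$. Loss: $\mathcal L_{0/1}(\mathrm m(x),y)=\mathbb E_{\hat y\sim \mathrm m(x)}[\mathbf 1\{\hat y\ne y\}]$. Risk: $\mathcal R(\mathrm m)=\mathbb E_{(x,y)\sim\mathcal D}[\mathcal L_{0/1}(\mathrm m(x),y)]$. Adversarial risk: $\mathcal R^{adv}(\mathrm m;\alpha_p)=\mathbb E_{(x,y)\sim\mathcal D}\big[\sup_{\tau}\mathcal L_{0/1}(\mathrm m(x+\tau),y)\big]$, where the supremum is over perturbations $\tau$ with $\|\tau\|_p\le\alpha_p$ and $x+\tau\in\mathcal X$ (so that $\mathrm m(x+\tau)$ is defined). *)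

(* Defs.v *)
From HB Require Import structures.
From mathcomp Require Import all_boot all_order all_algebra.
From mathcomp Require Import all_classical all_reals all_analysis.
From mathcomp Require Import measurable_realfun ess_sup_inf.
Set Implicit Arguments.
Unset Strict Implicit.
Unset Printing Implicit Defensive.
Import Order.TTheory GRing.Theory Num.Theory.
Import numFieldNormedType.Exports.
Local Open Scope classical_set_scope.
Local Open Scope ring_scope.

(* The label set {1, ..., K+1} is encoded as 'I_K.+1 (at least one label is
   needed for a probability measure on it to exist), with the discrete
   sigma-algebra. *)
HB.instance Definition _ (n : nat) := isPointed.Build 'I_n.+1 ord0.
HB.instance Definition _ (n : nat) :=
  @isMeasurable.Build default_measure_display 'I_n.+1 discrete_measurable
    discrete_measurable0 discrete_measurableC discrete_measurableU.

(* The subset X of R^d as a type of its own, with the trace of the Borel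
   sigma-algebra of R^d.  Measurable types are pointed in the library, hence
   the argument X0; a probability measure on X * Y exists only if X is
   nonempty. *)
Definition input_space (R : realType) (d : nat) (X : set (d.-tuple R))
  (X0 : X !=set0) : Type := set_type X.

Section input_space_instances.
Variables (R : realType) (d : nat) (X : set (d.-tuple R)) (X0 : X !=set0).

Definition input_val (x : input_space X0) : d.-tuple R := set_val x.

HB.instance Definition _ := Choice.on (input_space X0).
HB.instance Definition _ := isPointed.Build (input_space X0)
  (exist _ (projT1 (cid X0)) (mem_set (projT2 (cid X0)))).
HB.instance Definition _ := Measurable.copy (input_space X0)
  (g_sigma_algebra_preimageType input_val).

End input_space_instances.

HB.instance Definition _ d1 d2 (T1 : measurableType d1) (T2 : measurableType d2) :=
  isMeasurableFun.Build _ _ (T1 * T2)%type T1 fst measurable_fst.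

(* The value at p = -oo is irrelevant: p ranges over [1, +oo]. *)
Definition lp_norm (R : realType) (d : nat) (p : \bar R) (v : d.-tuple R) : R :=
  match p with
  | r%:E => (\sum_(i < d) `|tnth v i| `^ r) `^ r^-1
  | +oo%E => \big[Num.max/0]_(i < d) `|tnth v i|
  | -oo%E => 0
  end.

Definition tuple_add (R : realType) (d : nat) (u v : d.-tuple R) : d.-tuple R :=
  [tuple tnth u i + tnth v i | i < d].

Definition tuple_sub (R : realType) (d : nat) (u v : d.-tuple R) : d.-tuple R :=
  [tuple tnth u i - tnth v i | i < d].

Section divergences.
Variables (R : realType) (K : nat).
Implicit Types rho : probability 'I_K.+1 R.

Definition mass rho (k : 'I_K.+1) : R := fine (rho [set k]).

(* ln 0 = 0 in the library, so that 0 log 0 = 0. *)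
Definition entropy rho : R := - \sum_(k < K.+1) mass rho k * ln (mass rho k).

(* Renyi divergence of order beta in [1, +oo] (the value at -oo is irrelevant).
   The common dominating measure is the counting measure nu on the labels, for
   which the densities g and g' are the point masses.  In the branches below
   rho << rho', so that g vanishes wherever g' does: at those points g / g' is
   x / 0 = 0 and the integrands vanish. *)
Definition renyi_divergence (beta : \bar R) rho rho' : \bar R :=
  let nu : {measure set 'I_K.+1 -> \bar R} := counting in
  let g := mass rho in
  let g' := mass rho' in
  if `[< rho `<< rho' >] then
    match beta with
    | b%:E =>
        if b == 1 then (\int[nu]_k (g k * ln (g k / g' k))%:E)%E
        else (((b - 1)^-1)%:E * lne (\int[nu]_k (g' k * (g k / g' k) `^ b)%:E))%E
    | +oo%E => lne (ess_sup nu (fun k => (g k / g' k)%:E))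
    | -oo%E => 0%E
    end
  else +oo%E.

Definition loss01 rho (y : 'I_K.+1) : \bar R :=
  ('E_rho[fun yhat => (yhat != y)%:R])%E.

End divergences.

Section classifiers.
Variables (R : realType) (d K : nat) (X : set (d.-tuple R)) (X0 : X !=set0).
Implicit Types (D : probability (input_space X0 * 'I_K.+1)%type R)
  (m : input_space X0 -> probability 'I_K.+1 R) (p : \bar R) (alpha eps : R).

Definition robust p alpha eps
    (Div : probability 'I_K.+1 R -> probability 'I_K.+1 R -> \bar R) m : Prop :=
  forall x x' : input_space X0,
    lp_norm p (tuple_sub (input_val x) (input_val x')) <= alpha ->
    (Div (m x) (m x') <= eps%:E)%E.

(* The witness x' is the point x + tau of X. *)
Definition adv_loss p alpha m (x : input_space X0) (y : 'I_K.+1) : \bar R :=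
  ereal_sup [set l | exists tau : d.-tuple R, exists x' : input_space X0,
    [/\ lp_norm p tau <= alpha,
        input_val x' = tuple_add (input_val x) tau
      & l = loss01 (m x') y]].

Definition risk D m : \bar R := (\int[D]_z loss01 (m z.1) z.2)%E.

Definition adv_risk D p alpha m : \bar R :=
  (\int[D]_z adv_loss p alpha m z.1 z.2)%E.

Definition marginal D : probability (input_space X0) R := distribution D fst.

End classifiers.

(* Main.v *)
(* With rho = m x and rho' = m x', the gap between the two losses at the label y
   is rho_y - rho'_y, which is at most the probability 1 - sum_k rho_k rho'_k that
   independent draws from rho and rho' differ.  By Jensen,
     ln (sum_k rho_k rho'_k) >= sum_k rho_k ln rho'_k = - H rho - KL (rho, rho'),
   and KL <= D_beta <= eps, again by Jensen for 1 < beta < +oo.  The bound on the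
   gap then depends on x only, so it survives the supremum over x'. *)
Require Import Defs.
From HB Require Import structures.
From mathcomp Require Import all_boot all_order all_algebra.
From mathcomp Require Import all_classical all_reals all_analysis.
From mathcomp Require Import measurable_realfun ess_sup_inf.
From mathcomp Require Import finmap ring lra.
Set Implicit Arguments.
Unset Strict Implicit.
Unset Printing Implicit Defensive.
Import Order.TTheory GRing.Theory Num.Theory.
Import numFieldNormedType.Exports.
Local Open Scope classical_set_scope.
Local Open Scope ring_scope.

(** * Jensen's inequality for the logarithm under finitely many weights *)

Section finite_jensen.
Variables (R : realType) (I : finType) (w : I -> R).
Hypotheses (w_ge0 : forall i, 0 <= w i) (w_sum1 : \sum_i w i = 1).

(** Weights of total 1 cannot all vanish. Positivity of [v] is asked only on the support of [w],
    because [rho'] may have null labels outside the support of [rho]. *)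
Lemma sumr_weighted_gt0 (v : I -> R) : (forall i, 0 < w i -> 0 < v i) ->
  0 < \sum_i w i * v i.
Proof.
move=> v_gt0.
have wv_ge0 i : 0 <= w i * v i.
  have := w_ge0 i; rewrite le_eqVlt => /orP[/eqP <-|wi0]; first by rewrite mul0r.
  by rewrite mulr_ge0 ?w_ge0 // ltW // v_gt0.
rewrite lt_neqAle sumr_ge0 // andbT eq_sym; apply/negP.
rewrite psumr_eq0 // => /allP wv0.
have : \sum_i w i = 0.
  apply: big1 => i _; apply/eqP; have := w_ge0 i.
  rewrite le_eqVlt => /orP[/eqP <-//|wi0].
  have := wv0 i (mem_index_enum i); rewrite mulf_eq0 => /orP[//|/eqP vi0].
  by have := v_gt0 _ wi0; rewrite vi0 ltxx.
by rewrite w_sum1 => /eqP; rewrite oner_eq0.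
Qed.

(** The tangent bound [ln t <= t - 1] at [t = v i / S] controls each term, and the corrections
    [w i * v i / S - w i] sum to 0. *)
Lemma le_sum_ln_ln_sum (v : I -> R) : (forall i, 0 < w i -> 0 < v i) ->
  \sum_i w i * ln (v i) <= ln (\sum_i w i * v i).
Proof.
move=> v_gt0; have S0 := sumr_weighted_gt0 v_gt0.
set S := \sum_i w i * v i in S0 *.
have le_term i : w i * ln (v i) <= w i * ln S + (w i * v i / S - w i).
  have := w_ge0 i; rewrite le_eqVlt => /orP[/eqP <-|wi0].
    by rewrite !mul0r subr0 addr0.
  have vi0 := v_gt0 _ wi0.
  have -> : w i * ln S + (w i * v i / S - w i) = w i * (ln S + (v i / S - 1)).
    by ring.
  rewrite ler_pM2l // -lerBlDl -ln_div ?posrE //.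
  have := @le_ln1Dx R (v i / S - 1); rewrite (addrC 1) subrK; apply.
  by rewrite ltrBrDl subrr divr_gt0.
apply: (le_trans (ler_sum _ (fun i _ => le_term i))).
rewrite big_split/= -mulr_suml w_sum1 mul1r sumrB -mulr_suml w_sum1 -/S.
by rewrite divff ?gt_eqF // subrr addr0.
Qed.

End finite_jensen.

(** * Integrals over the finite label set as finite sums *)

Section ordinal_measure.
Variables (R : realType) (n : nat).

Lemma measurable_fun_ord d (T : measurableType d) (f : 'I_n.+1 -> T) :
  measurable_fun [set: 'I_n.+1] f.
Proof. by move=> _ Y _. Qed.

Lemma ge0_integral_ord (mu : {measure set 'I_n.+1 -> \bar R}) (f : 'I_n.+1 -> R) :
  (forall k, 0 <= f k) ->
  (\int[mu]_k (f k)%:E = \sum_(k < n.+1) (f k)%:E * mu [set k])%E.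
Proof.
move=> f0.
transitivity (\int[mu]_x \sum_(k < n.+1) ((f k)%:E * (\1_[set k] x)%:E))%E.
  apply: eq_integral => x _; rewrite (bigD1 x) //= indicE mem_set // mule1.
  rewrite big1 ?adde0 // => i ix; rewrite indicE memNset ?mule0 //= => xi.
  by rewrite xi eqxx in ix.
rewrite ge0_integral_sum //=; last by move=> i x _; rewrite mule_ge0 ?lee_fin.
apply: eq_bigr => k _; rewrite ge0_integralZl_EFin //.
by rewrite integral_indic // setIT.
Qed.

Lemma counting_set1 (T : choiceType) (t : T) : counting [set t] = 1%:E :> \bar R.
Proof. by rewrite /counting asboolT // fset_set1 cardfs1. Qed.

(** The Kullback-Leibler integrand can change sign, so the nonnegative case is applied to the
    positive and negative parts separately. *)
Lemma integral_counting_ord (f : 'I_n.+1 -> R) :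
  (\int[counting : {measure set 'I_n.+1 -> \bar R}]_k (f k)%:E =
   (\sum_(k < n.+1) f k)%:E)%E.
Proof.
have ge0 g : (forall k, 0 <= g k) ->
    (\int[counting : {measure set 'I_n.+1 -> \bar R}]_k (g k)%:E =
     (\sum_(k < n.+1) g k)%:E)%E.
  move=> g0; rewrite ge0_integral_ord // -sumEFin; apply: eq_bigr => k _.
  by rewrite /= counting_set1 mule1.
rewrite integralE.
under eq_integral do rewrite funeposE -EFin_max.
rewrite ge0; last by move=> k; rewrite le_max lexx orbT.
under eq_integral do rewrite funenegE -EFinN -EFin_max.
rewrite ge0; last by move=> k; rewrite le_max lexx orbT.
rewrite -EFinB -sumrB; congr _%:E; apply: eq_bigr => k _.
by rewrite !maxElt oppr_lt0; case: (ltrgtP (f k) 0) => [h|h|->]; lra.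
Qed.

End ordinal_measure.

(** * Point masses, entropy, and the estimate for a pair of distributions *)

Section masses.
Variables (R : realType) (K : nat).
Implicit Types rho : probability 'I_K.+1 R.

Lemma massE rho k : rho [set k] = (mass rho k)%:E.
Proof. by rewrite /mass fineK // fin_num_measure. Qed.

Lemma mass_ge0 rho k : 0 <= mass rho k.
Proof. by rewrite -lee_fin -massE. Qed.

Lemma sum_mass rho : \sum_(k < K.+1) mass rho k = 1.
Proof.
apply: EFin_inj; rewrite -(@probability_setT _ _ _ rho) -sumEFin.
have := @ge0_integral_ord R K rho (fun=> 1) (fun=> ler01).
rewrite integral_cst // mul1e => ->.
by apply: eq_bigr => k _; rewrite mul1e -massE.
Qed.

Lemma sum_mass_neq rho y : \sum_(k < K.+1 | k != y) mass rho k = 1 - mass rho y.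
Proof. by rewrite -(sum_mass rho) [in RHS](bigD1 y) //= addrAC subrr add0r. Qed.

Lemma mass_le1 rho y : mass rho y <= 1.
Proof.
by rewrite -subr_ge0 -sum_mass_neq sumr_ge0 // => k _; exact: mass_ge0.
Qed.

Lemma entropy_ge0 rho : 0 <= entropy rho.
Proof.
rewrite /entropy -sumrN sumr_ge0 // => k _.
by rewrite -mulrN mulr_ge0 ?mass_ge0 // oppr_ge0 ln_le0 // mass_le1.
Qed.

Lemma loss01E rho y : loss01 rho y = (1 - mass rho y)%:E.
Proof.
rewrite /loss01 unlock ge0_integral_ord; last by move=> k.
rewrite -[in RHS](sum_mass rho) (bigD1 y) //= [in RHS](bigD1 y) //= eqxx mul0e add0e.
rewrite addrC addrK -sumEFin; apply: eq_bigr => k /negbTE ky.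
by rewrite ky mul1e massE.
Qed.

Lemma dominates_mass rho rho' k : rho `<< rho' ->
  0 < mass rho k -> 0 < mass rho' k.
Proof.
move=> dom rk; rewrite lt_neqAle mass_ge0 andbT eq_sym.
apply: contraL rk => /eqP r'k.
have r'0 : null_set rho' [set k].
  move=> A _ Ak; apply/eqP; rewrite eq_le measure_ge0 andbT.
  have <- : rho' [set k] = 0%E by rewrite massE r'k.
  by apply: le_measure => //; exact: mem_set.
have /dom/(_ [set k] I (@subset_refl _ _)) := r'0.
by rewrite massE => -[->]; rewrite ltxx.
Qed.

Lemma expN_entropy_kl_le rho rho' : rho `<< rho' ->
  expR (- entropy rho - \sum_k mass rho k * ln (mass rho k / mass rho' k)) <=
  \sum_k mass rho k * mass rho' k.
Proof.
move=> dom.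
have pos k := @dominates_mass rho rho' k dom.
rewrite -[leRHS]lnK ?posrE; last first.
  exact: sumr_weighted_gt0 (mass_ge0 rho) (sum_mass rho) _ pos.
rewrite ler_expR.
apply: le_trans (le_sum_ln_ln_sum (mass_ge0 rho) (sum_mass rho) pos).
(* The exponent equals [\sum_k mass rho k * ln (mass rho' k)]: the logarithm of the ratio splits on
   the support of [rho], and all terms vanish off it. *)
rewrite opprK -sumrB le_eqVlt; apply/orP; left; apply/eqP.
apply: eq_bigr => k _; have := mass_ge0 rho k.
rewrite le_eqVlt => /orP[/eqP <-|rk]; first by rewrite !mul0r subr0.
by rewrite ln_div ?posrE ?pos //; ring.
Qed.

(** A finite bound excludes the value [+oo], hence domination. Order 1 is the claim itself, finite
    orders above 1 use Jensen, and order [+oo] bounds every log-ratio on the support of [rho]. *)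
Lemma kl_le_renyi beta (eps : R) rho rho' : (1 <= beta)%E ->
  (renyi_divergence beta rho rho' <= eps%:E)%E ->
  rho `<< rho' /\ \sum_k mass rho k * ln (mass rho k / mass rho' k) <= eps.
Proof.
rewrite /renyi_divergence; case: asboolP => [dom|_ _]; last by rewrite leNgt ltry.
move=> beta1 Deps; split => //.
have pos k := @dominates_mass rho rho' k dom.
have rpos k : 0 < mass rho k -> 0 < mass rho k / mass rho' k.
  by move=> rk; rewrite divr_gt0 // pos.
case: beta beta1 Deps => [b| |//].
- rewrite lee_fin => b1; case: eqP => [_|/eqP bneq1].
    by rewrite integral_counting_ord lee_fin.
  have b1_gt0 : 0 < b - 1 by rewrite subr_gt0 lt_neqAle eq_sym bneq1.
  have b0 : 0 < b by rewrite (lt_le_trans ltr01).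
  have powpos k : 0 < mass rho k -> 0 < (mass rho k / mass rho' k) `^ (b - 1).
    by move=> /rpos/powR_gt0.
  (* Moving one factor of the ratio out of the power turns the weights [rho'] into [rho], the
     weights of the Kullback-Leibler sum. *)
  rewrite integral_counting_ord (_ : \sum_k _ =
      \sum_k mass rho k * (mass rho k / mass rho' k) `^ (b - 1)); last first.
    apply: eq_bigr => k _; have := mass_ge0 rho k.
    rewrite le_eqVlt => /orP[/eqP <-|rk].
      by rewrite !mul0r powR0 ?mulr0 // gt_eqF.
    rewrite -mulr_powRB1 ?ltW ?rpos // mulrA mulrCA divff ?mulr1 //.
    by rewrite gt_eqF // pos.
  rewrite lne_EFin; last first.
    exact: sumr_weighted_gt0 (mass_ge0 rho) (sum_mass rho) _ powpos.
  (* Both inequalities are scaled by [b - 1 > 0]; Jensen for the powers [b - 1] of the ratio then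
     gives the factor [b - 1] through [ln_powR]. *)
  rewrite lee_fin ler_pdivrMl // -[X in _ -> is_true X](ler_pM2l b1_gt0).
  apply: le_trans; have := le_sum_ln_ln_sum (mass_ge0 rho) (sum_mass rho) powpos.
  apply: le_trans; rewrite mulr_sumr; apply: ler_sum => k _.
  by rewrite ln_powR mulrCA.
- move=> _ Deps.
  have {}Deps : (ess_sup counting (fun k => (mass rho k / mass rho' k)%:E)
      <= (expR eps)%:E)%E.
    set e := ess_sup _ _ in Deps *.
    (* [expeR] inverts [lne] only on nonnegative values; a negative [e] lies below [expR eps]
       anyway. *)
    have [e_ge0|/ltW e_le0] := leP 0%E e; last first.
      by rewrite (le_trans e_le0) // lee_fin expR_ge0.
    by rewrite -(lneK (x := e)) ?in_itv /= ?e_ge0 ?leey // -[leRHS]/(expeR eps%:E) lee_expeR.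
  have ratio k : mass rho k / mass rho' k <= expR eps.
    (* Every singleton has counting measure 1, so the exceptional null set contains no label and the
       essential bound holds everywhere. *)
    have [N [mN N0 hN]] := elimT ess_supP Deps.
    apply: contrapT => nk.
    have Nk : [set k] `<=` N by move=> _ ->; apply: hN => /=; rewrite lee_fin.
    have : (counting [set k] <= counting N :> \bar R)%E.
      by apply: (le_measure (counting : {measure set 'I_K.+1 -> \bar R})) => //;
        exact: mem_set.
    by rewrite counting_set1 N0 lee_fin ler10.
  rewrite -[leRHS]mul1r -(sum_mass rho) mulr_suml; apply: ler_sum => k _.
  have := mass_ge0 rho k.
  rewrite le_eqVlt => /orP[/eqP <-|rk]; first by rewrite !mul0r.
  by rewrite ler_pM2l // -[leRHS]expRK ler_ln ?posrE ?expR_gt0 ?rpos.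
Qed.

Lemma loss01_gap_le beta (eps : R) rho rho' y : (1 <= beta)%E ->
  (renyi_divergence beta rho rho' <= eps%:E)%E ->
  mass rho y - mass rho' y + expR (- eps) * expR (- entropy rho) <= 1.
Proof.
move=> beta1 /(kl_le_renyi beta1)[dom kl].
have := expN_entropy_kl_le dom.
have : expR (- eps) * expR (- entropy rho) <=
    expR (- entropy rho - \sum_k mass rho k * ln (mass rho k / mass rho' k)).
  by rewrite -expRD ler_expR addrC lerD2l lerN2.
move=> /le_trans/[apply] H.
(* Two independent draws that agree are either both [y] or both different from [y]. *)
have : \sum_k mass rho k * mass rho' k <=
    mass rho y * mass rho' y + (1 - mass rho y) * (1 - mass rho' y).
  rewrite (bigD1 y) //= lerD2l -!sum_mass_neq mulr_suml.
  apply: ler_sum => k ky; apply: ler_wpM2l; first exact: mass_ge0.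
  by rewrite (bigD1 k) //= lerDl sumr_ge0 // => i _; exact: mass_ge0.
(* With [a] and [b] the masses at [y], [1 - (a - b)] exceeds [a b + (1 - a) (1 - b)] by exactly
   [2 b (1 - a)]. *)
have : 0 <= mass rho' y * (1 - mass rho y).
  by rewrite mulr_ge0 ?mass_ge0 // subr_ge0 mass_le1.
move: H; set c := expR _ * _; set s := \sum_k _.
by set a := mass rho y; set b := mass rho' y; lra.
Qed.

End masses.

(** Robustness measures [x - x'], which is the opposite of the perturbation [tau] leading from [x]
    to [x']. *)
Lemma lp_norm_opp (R : realType) (d : nat) (p : \bar R) (u v : d.-tuple R) :
  (forall i, tnth u i = - tnth v i) -> lp_norm p u = lp_norm p v.
Proof.
move=> uv; have norm_uv i : `|tnth u i| = `|tnth v i| by rewrite uv normrN.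
rewrite /lp_norm; case: p => [r| |]; last by [].
  by under eq_bigr do rewrite norm_uv.
by under eq_bigr do rewrite norm_uv.
Qed.

(** * Pointwise bounds on the adversarial loss *)

Section classifiers.
Variables (R : realType) (d K : nat) (X : set (d.-tuple R)) (X0 : X !=set0).
Implicit Types (m : input_space X0 -> probability 'I_K.+1 R) (p : \bar R).

Lemma adv_loss_le p (alpha eps : R) (beta : \bar R) m x y :
  (1 <= beta)%E -> robust p alpha eps (renyi_divergence beta) m ->
  (adv_loss p alpha m x y + (expR (- eps) * expR (- entropy (m x)))%:E
     <= 1 + loss01 (m x) y)%E.
Proof.
(* Isolating the supremum leaves a right-hand side free of [tau], so it suffices to bound each
   perturbed loss. *)
move=> beta1 rob; rewrite -leeBrDr //; apply: ge_ereal_sup => _ [tau [x' [tau_le x'E ->]]].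
have /(loss01_gap_le y beta1) : (renyi_divergence beta (m x) (m x') <= eps%:E)%E.
  apply: rob; rewrite (@lp_norm_opp _ _ _ _ tau) // => i.
  by rewrite x'E !tnth_mktuple opprD addrA subrr add0r.
rewrite leeBrDr // !loss01E -!EFinD lee_fin; lra.
Qed.

(** The perturbation 0 is admissible. This makes the adversarial loss nonnegative, as its
    integration requires. *)
Lemma loss01_le_adv_loss p (alpha : R) m x y : 0 <= alpha -> (1 <= p)%E ->
  (loss01 (m x) y <= adv_loss p alpha m x y)%E.
Proof.
move=> alpha0 p1; apply: ereal_sup_ubound.
exists [tuple 0 | i < d], x; split => //.
  suff -> : lp_norm p [tuple 0 | i < d] = 0 by [].
  rewrite /lp_norm; case: p p1 => [r r1|_|//].
    rewrite big1 => [|i _].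
      by rewrite powR0 // gt_eqF // invr_gt0 (lt_le_trans ltr01).
    by rewrite tnth_mktuple normr0 powR0 // gt_eqF // (lt_le_trans ltr01).
  under eq_bigr do rewrite tnth_mktuple normr0.
  by rewrite big_const_idem //= maxElt ltxx.
by apply: eq_from_tnth => i; rewrite !tnth_mktuple addr0.
Qed.

(** * Measurability of the integrands *)

Section measurability.
Variable m : input_space X0 -> probability 'I_K.+1 R.
Hypothesis hm : measurable_fun [set: input_space X0]
  (m : input_space X0 -> pprobability 'I_K.+1 R).

Lemma measurable_mass k : measurable_fun [set: input_space X0] (fun x => mass (m x) k).
Proof.
apply: measurableT_comp => //.
exact: (measurable_kernel (kprobability hm) [set k]).
Qed.

Lemma measurable_expN_entropy :
  measurable_fun [set: input_space X0] (fun x => expR (- entropy (m x))).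
Proof.
apply: measurableT_comp => //; apply: measurableT_comp => //.
apply: measurableT_comp => //; apply: measurable_sum => k.
apply: measurable_funM; first exact: measurable_mass.
by apply: measurableT_comp => //; exact: measurable_mass.
Qed.

Lemma measurable_loss01 :
  measurable_fun [set: input_space X0 * 'I_K.+1] (fun z => loss01 (m z.1) z.2).
Proof.
under eq_fun do rewrite loss01E.
apply/measurable_EFinP; apply: measurable_funB => //.
(* The label selects which mass is read; a sum over labels with indicators separates the dependence
   on the input from that on the label. *)
rewrite (_ : (fun _ => _) =
    fun z => \sum_(k < K.+1) mass (m z.1) k * (z.2 == k)%:R); last first.
  apply/funext => z; rewrite (bigD1 z.2) //= eqxx mulr1 big1 ?addr0 // => k.
  by rewrite eq_sym => /negbTE ->; rewrite mulr0.
apply: measurable_sum => k; apply: measurable_funM.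
  exact: measurableT_comp (measurable_mass k) measurable_fst.
exact: measurableT_comp (measurable_fun_ord (fun y => (y == k)%:R : R)) measurable_snd.
Qed.

End measurability.
End classifiers.

(** * Integration of the pointwise bound over [D] *)

Theorem theorem3 (R : realType) (d K : nat)
  (X : set (d.-tuple R)) (X0 : X !=set0)
  (hX : forall x, X x -> forall i, -1 <= tnth x i <= 1)
  (D : probability (input_space X0 * 'I_K.+1)%type R)
  (p : \bar R) (hp : (1 <= p)%E)
  (alpha : R) (halpha : 0 < alpha)
  (eps : R) (heps : 0 <= eps)
  (beta : \bar R) (hbeta : (1 <= beta)%E)
  (m : input_space X0 -> probability 'I_K.+1 R)
  (hm : measurable_fun [set: input_space X0] (m : input_space X0 -> pprobability 'I_K.+1 R))
  (hadv : measurable_fun [set: (input_space X0 * 'I_K.+1)%type]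
     (fun z => adv_loss p alpha m z.1 z.2))
  (hrob : robust p alpha eps (renyi_divergence beta) m) :
  (adv_risk D p alpha m - risk D m
     <= 1 - (expR (- eps))%:E
            * 'E_(marginal D)[fun x => expR (- entropy (m x))])%E.
Proof.
have exp_ge0 (z : input_space X0 * 'I_K.+1) :
    (0 <= (expR (- eps) * expR (- entropy (m z.1)))%:E)%E.
  by rewrite lee_fin mulr_ge0 ?expR_ge0.
have mexp : measurable_fun [set: input_space X0 * 'I_K.+1]
    (fun z => (expR (- eps) * expR (- entropy (m z.1)))%:E).
  apply/measurable_EFinP; apply: measurable_funM => //.
  exact: measurableT_comp (measurable_expN_entropy hm) measurable_fst.
have loss_ge0 (z : input_space X0 * 'I_K.+1) : (0 <= loss01 (m z.1) z.2)%E.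
  by rewrite loss01E lee_fin subr_ge0 mass_le1.
have adv_ge0 (z : input_space X0 * 'I_K.+1) : (0 <= adv_loss p alpha m z.1 z.2)%E.
  exact: le_trans (loss_ge0 z) (loss01_le_adv_loss _ _ _ (ltW halpha) hp).
(* The marginal is the image of [D] under [fst], so the expectation becomes an integral over [D],
   like the two risks. *)
have -> : ((expR (- eps))%:E * 'E_(marginal D)[fun x => expR (- entropy (m x))] =
    \int[D]_z (expR (- eps) * expR (- entropy (m z.1)))%:E)%E.
  rewrite unlock /marginal ge0_integral_distribution //=.
  - rewrite -ge0_integralZl_EFin ?expR_ge0 //.
    + apply/measurable_EFinP.
      exact: measurableT_comp (measurable_expN_entropy hm) measurable_fst.
  - by apply/measurable_EFinP; exact: measurable_expN_entropy.
have int1 : (\int[D]_z 1 = 1)%E.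
  by rewrite integral_cst // mul1e; exact: probability_setT.
(* Terms move across an inequality in [\bar R] only when finite; integrands with values in [0, 1]
   ensure this. *)
have int01_fin (f : input_space X0 * 'I_K.+1 -> \bar R) :
    measurable_fun setT f -> (forall z, 0 <= f z <= 1)%E ->
    (\int[D]_z f z)%E \is a fin_num.
  move=> mf f01; have f_ge0 z : (0 <= f z)%E by have /andP[] := f01 z.
  rewrite ge0_fin_numE ?integral_ge0 // (@le_lt_trans _ _ (\int[D]_z 1)%E) //.
    by apply: ge0_le_integral => // z _; have /andP[] := f01 z.
  by rewrite int1 ltry.
have risk_fin : risk D m \is a fin_num.
  apply: int01_fin => [|z]; first exact: measurable_loss01.
  by rewrite loss_ge0 loss01E lee_fin gerBl mass_ge0.
have exp_fin : (\int[D]_z (expR (- eps) * expR (- entropy (m z.1)))%:E)%E \is a fin_num.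
  apply: int01_fin => // z; rewrite exp_ge0 lee_fin -expRD.
  by rewrite -expR0 ler_expR -opprD oppr_le0 addr_ge0 // entropy_ge0.
(* The goal becomes subtraction-free, with 1 written as an integral, so that [adv_loss_le] applies
   under a single integral on each side. *)
rewrite leeBlDr // addeAC leeBrDr // /adv_risk /risk.
rewrite -[X in (_ <= X + _)%E]int1.
rewrite -!ge0_integralD //; last exact: measurable_loss01.
apply: ge0_le_integral => //.
- by move=> z _; apply: adde_ge0.
- exact: emeasurable_funD.
- by apply: emeasurable_funD => //; exact: measurable_loss01.
- by move=> z _; exact: adv_loss_le hrob.
Qed.
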